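(* Let $X=\{X_t\}_{t\ge 0}$ be a Markov chain on $(\mathsf X,\mathscr X)$ with transition kernel $Q$ which is $\psi$-irreducible, aperiodic and positive Harris recurrent, $\pi$-reversible for a probability measure $\pi$, and geometrically ergodic, and let $g:\mathsf X\to\mathbb R$ satisfy $\int g(x)^2\pi(dx)<\infty$. Let $\gamma$ be the autocovariance sequence $\gamma(k)=\mathrm{Cov}_\pi(g(X_0),g(X_{|k|}))$, $k\in\mathbb Z$, and let $F$ be the representing measure for $\gamma$, i.e. the measure supported in $[-1,1]$ with $\gamma(k)=\int x^{|k|}F(dx)$ for all $k\in\mathbb Z$. Suppose $\delta\in(0,1]$ is chosen so that $F$ is supported on $[-1+\delta,1-\delta]$. Let $r_M$ be an initial autocovariance sequence estimator satisfying conditions (R.1)–(R.3) of the context. Then for each initial condition $x\in\mathsf X$, $$\|\gamma-\Pi_\delta(r_M)\|^2\longrightarrow 0\quad\text{as } M\to\infty,\qquad P_x\text{-almost surely.}$$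
   Context: **Markov chain.** $\mathsf X$ is a complete separable metric space with Borel $\sigma$-algebra $\mathscr X$. $P_\nu$ (resp. $P_x$) is the law on the canonical sequence space of the chain with kernel $Q$ and initial distribution $\nu$ (resp. started at $x$); $\mathrm{Cov}_\pi$ is covariance under $P_\pi$. $Q$ is $\pi$-reversible if $\int f_1\,(Qf_2)\,d\pi=\int (Qf_1)\,f_2\,d\pi$ for all $f_1,f_2\in L^2(\pi)$, where $Qf(x)=\int Q(x,dy)f(y)$. Geometric ergodicity: there are $\rho<1$ and a non-negative (finite) function $V$ on $\mathsf X$ with $\|Q^n(x,\cdot)-\pi\|_{\mathrm{TV}}\le V(x)\rho^n$ for all $x\in\mathsf X$ and all $n$. $\psi$-irreducibility, aperiodicity and positive Harris recurrence are in the sense of Meyn and Tweedie. **Moment sequences.** $\ell_2(\mathbb Z)$ is the space of square-summable real sequences on $\mathbb Z$, with norm $\|\cdot\|$. $\mathscr M_\infty(\delta)$ is the set of $m\in\mathbb R^{\mathbb Z}$ for which there is a positive measure $\mu$ (a representing measure) supported on $[-1+\delta,1-\delta]$ with $m(k)=\int x^{|k|}\mu(dx)$ for all $k\in\mathbb Z$ (convention $0^0=1$). For $r\in\ell_2(\mathbb Z)$, $\Pi_\delta(r)=\arg\min_{m\in\mathscr M_\infty(\delta)\cap\ell_2(\mathbb Z)}\|r-m\|^2$ (it exists and is unique). **Conditions on the initial estimator.** For each $M$, $r_M=\{r_M(k)\}_{k\in\mathbb Z}$ is a real sequence computed from $X_0,\dots,X_{M-1}$ such that: (R.1) for each $k\in\mathbb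 Z$, $r_M(k)\to\gamma(k)$ as $M\to\infty$, $P_x$-a.s., for any $x\in\mathsf X$; (R.2) $r_M(k)=0$ for $k\ge n(M)$, for some $n(M)<\infty$; (R.3) $r_M(k)=r_M(-k)$ and $r_M(0)\ge |r_M(k)|$ for each $k\in\mathbb Z$. *)

(* Defs.v *)
(* MathComp-Analysis. *)
From HB Require Import structures.
From mathcomp Require Import all_boot all_order all_algebra.
From mathcomp Require Import all_classical all_reals all_analysis.

Set Implicit Arguments.
Unset Strict Implicit.
Unset Printing Implicit Defensive.

Import Order.TTheory GRing.Theory Num.Theory.
Import numFieldNormedType.Exports.

Local Open Scope classical_set_scope.
Local Open Scope ring_scope.
Local Open Scope ereal_scope.

(* The library's measurable types and complete spaces are pointed, that is,
   nonempty; this costs nothing for a space carrying a probability measure. *)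
#[short(type="completeMetricType")]
HB.structure Definition CompleteMetric (K : numDomainType) :=
  {T of Metric K T & Uniform_isComplete T & isPointed T}.

Definition separable_space (T : topologicalType) : Prop :=
  exists2 D : set T, countable D & dense D.

Notation borelType X := (g_sigma_algebraType (@open X)).

(* The canonical sequence space, with the sigma-algebra generated by the
   coordinate maps. *)
Definition coordinate_sets d (T : measurableType d) : set (set (nat -> T)) :=
  \bigcup_n preimage_set_system setT (fun w : nat -> T => w n) measurable.

Notation path_space T := (g_sigma_algebraType (@coordinate_sets _ T)).

Section markov_chain.
Context d (T : measurableType d) (R : realType).
Implicit Types (Q : R.-pker T ~> T) (P : probability T R -> probability (path_space T) R).

(* The probability, from [x], that the next [n] steps fall successively in
   [A 0], ..., [A n.-1]. *)
Fixpoint next_in Q (n : nat) (A : nat -> set T) (x : T) : \bar R :=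
  if n is n'.+1 then \int[Q x]_(y in A 0%N) next_in Q n' (fun i => A i.+1) y
  else 1.

(* [mu] is the law of the chain with kernel [Q] and initial distribution [nu];
   the finite-dimensional distributions determine [mu] uniquely. *)
Definition chain_law Q (nu : probability T R)
    (mu : probability (path_space T) R) : Prop :=
  forall (n : nat) (A : nat -> set T), (forall i, measurable (A i)) ->
    mu [set w : path_space T | forall i, (i <= n)%N -> A i (w i)] =
    \int[nu]_(x in A 0%N) next_in Q n (fun i => A i.+1) x.

Definition start_at P (x : T) : probability (path_space T) R :=
  P (@dirac d T x R).

Definition first_states (w : path_space T) (M : nat) : M.-tuple T :=
  [tuple w i | i < M].

Fixpoint kernel_iter Q (n : nat) (x : T) (A : set T) : \bar R :=
  if n is n'.+1 then \int[Q x]_y kernel_iter Q n' y A else \d_x A.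

Definition hit (A : set T) : set (path_space T) :=
  [set w | exists2 n, (0 < n)%N & A (w n)].

Definition infinitely_often (A : set T) : set (path_space T) :=
  [set w | forall n, exists2 m, (n <= m)%N & A (w m)].

Definition irreducibility_measure P
    (phi : {sigma_finite_measure set T -> \bar R}) : Prop :=
  0 < phi setT /\
  forall A, measurable A -> 0 < phi A -> forall x, 0 < start_at P x (hit A).

(* As in Meyn and Tweedie, [psi] is a maximal irreducibility measure. *)
Definition psi_irreducible P
    (psi : {sigma_finite_measure set T -> \bar R}) : Prop :=
  irreducibility_measure P psi /\
  forall phi, irreducibility_measure P phi ->
    forall A, measurable A -> psi A = 0 -> phi A = 0.

Definition is_cycle Q (psi : set T -> \bar R) (p : nat) (D : nat -> set T) :
    Prop :=
  [/\ (0 < p)%N,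
      forall i, (i < p)%N -> measurable (D i),
      trivIset `I_p D,
      forall i, (i < p)%N -> forall x, D i x -> Q x (D (i.+1 %% p)%N) = 1 &
      psi (~` \bigcup_(i in `I_p) D i) = 0].

(* The whole space is always a 1-cycle, so this says that the largest length
   of a cycle is 1. *)
Definition aperiodic Q (psi : set T -> \bar R) : Prop :=
  forall p D, is_cycle Q psi p D -> p = 1%N.

Definition harris_recurrent P (psi : set T -> \bar R) : Prop :=
  forall A, measurable A -> 0 < psi A ->
    forall x, A x -> start_at P x (infinitely_often A) = 1.

Definition invariant Q (mu : probability T R) : Prop :=
  forall A, measurable A -> \int[mu]_x Q x A = mu A.

Definition positive_harris_recurrent Q P (psi : set T -> \bar R) : Prop :=
  harris_recurrent P psi /\ exists mu, invariant Q mu.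

Definition reversible Q (pi : probability T R) : Prop :=
  forall f1 f2 : T -> R, f1 \in Lfun pi 2%:E -> f2 \in Lfun pi 2%:E ->
    \int[pi]_x ((f1 x)%:E * \int[Q x]_y (f2 y)%:E) =
    \int[pi]_x ((\int[Q x]_y (f1 y)%:E) * (f2 x)%:E).

(* For a signed measure this is the dual norm [sup_(|f| <= 1) |nu f|], that is,
   twice the supremum over events when [nu] is a difference of probabilities. *)
Definition tv_norm (nu : set T -> \bar R) : \bar R :=
  ereal_sup [set nu A | A in measurable] -
  ereal_inf [set nu A | A in measurable].

Definition geometrically_ergodic Q (pi : probability T R) : Prop :=
  exists (rho : R) (V : T -> R),
    [/\ (rho < 1)%R, forall x, (0 <= V x)%R &
        forall x n, tv_norm (fun A => kernel_iter Q n x A - pi A) <=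
                    (V x * rho ^+ n)%:E].

(* [Ppi] is the law of the stationary chain. *)
Definition autocovariance (Ppi : probability (path_space T) R) (g : T -> R)
    (k : int) : R :=
  fine (covariance Ppi (fun w : path_space T => g (w 0%N))
                       (fun w : path_space T => g (w `|k|%N))).

End markov_chain.

Section moment_sequences.
Context (R : realType).
Implicit Types (mu : {measure set R -> \bar R}) (m r : int -> R).

Definition supported_in mu (a b : R) : Prop := mu (~` `[a, b]) = 0.

Definition represents mu m : Prop :=
  forall k : int, (m k)%:E = \int[mu]_x (x ^+ `|k|%N)%:E.

Definition moment_seq (delta : R) : set (int -> R) :=
  [set m | exists mu, supported_in mu (-1 + delta) (1 - delta) /\
                      represents mu m].

(* The squared norm takes the value [+oo] outside of [l2Z]. *)
Definition sqnorm m : \bar R := \esum_(k in [set: int]) ((m k) ^+ 2)%:E.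

Definition l2Z : set (int -> R) := [set m | sqnorm m < +oo].

Definition argmin (I : Type) (D : set I) (f : I -> \bar R) : set I :=
  [set a | D a /\ forall b, D b -> f a <= f b].

(* [Pi] is a function realizing the projection
   [r |-> argmin_(m in moment_seq delta `&` l2Z) |r - m|^2] on [l2Z]; its values
   elsewhere are arbitrary. *)
Definition moment_projection (delta : R) (Pi : (int -> R) -> (int -> R)) :
    Prop :=
  forall r, l2Z r ->
    argmin (moment_seq delta `&` l2Z) (fun m => sqnorm (r \- m)%R) (Pi r).

End moment_sequences.

(* Main.v *)
(** Let [p] be the projection of [r], [d = gamma - p] and [e = gamma - r]. The
    constraint set is convex, so the midpoint of [p] and [gamma] is no closer to
    [r] than [p] is, which gives [|d|^2 <= 2 * sum |d k| |e k|]. Moment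
    sequences decay like [(1 - delta)^|k|], whence [|d|^2 <= 2 (gamma 0 + p 0) eps]
    with [eps = sum |e k| (1 - delta)^|k|]. As [(gamma 0 - p 0)^2 <= |d|^2],
    the unknown mass [p 0] is absorbed, leaving a bound in [gamma 0] and [eps]
    alone; and [eps] tends to [0] by dominated convergence, (R.3) bounding
    [e] by the convergent sequence [r 0]. *)
Require Import Defs.
From HB Require Import structures.
From mathcomp Require Import all_boot all_order all_algebra.
From mathcomp Require Import all_classical all_reals all_analysis.
From mathcomp Require Import measurable_realfun lra.

Set Implicit Arguments.
Unset Strict Implicit.
Unset Printing Implicit Defensive.

Import Order.TTheory GRing.Theory Num.Theory.
Import numFieldNormedType.Exports.

Local Open Scope classical_set_scope.
Local Open Scope ring_scope.
Local Open Scope ereal_scope.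

(** * Moment sequences: decay and convexity *)

Lemma represents_mass (R : realType) (mu : {measure set R -> \bar R})
  (m : int -> R) : represents mu m -> mu setT = (m 0)%:E.
Proof.
move=> /(_ 0%R) ->; under eq_integral do rewrite expr0.
by rewrite integral_cst ?mul1e.
Qed.

Lemma measurable_expr_EFin (R : realType) (n : nat) :
  measurable_fun [set: R] (EFin \o (fun x => x ^+ n)%R).
Proof. by apply/measurable_EFinP; exact: measurable_funX. Qed.

Lemma moment_abs_le (R : realType) (mu : {measure set R -> \bar R})
  (q : R) (n : nat) : (0 <= q)%R -> supported_in mu (- q) q ->
  \int[mu]_x `|(x ^+ n)%:E| <= (q ^+ n)%:E * mu setT.
Proof.
move=> q0 muq; apply: integral_le_bound => //.
- exact: measurable_expr_EFin.
- by rewrite lee_fin exprn_ge0.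
- exists (~` `[(- q)%R, q]); split => //; first exact: measurableC.
  move=> x /= xN xq; apply: xN => _; move: xq.
  rewrite in_itv /= -ler_norml => xq.
  by rewrite lee_fin normrX lerXn2r.
Qed.

(** The total mass of the representing measure is [m 0], and [|x| <= 1 - delta] almost everywhere
    for it. *)
Lemma moment_seq_decay (R : realType) (delta : R) (m : int -> R) (k : int) :
  (delta <= 1)%R -> moment_seq delta m ->
  (0 <= m 0)%R /\ (`|m k| <= m 0 * (1 - delta) ^+ `|k|)%R.
Proof.
move=> d1 [mu [supp rep]]; have mass := represents_mass rep.
split; first by rewrite -lee_fin -mass measure_ge0.
have q0 : (0 <= 1 - delta)%R by rewrite subr_ge0.
rewrite -lee_fin -abse_EFin rep (le_trans (le_abse_integral _ _ _))//.
  exact: measurable_expr_EFin.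
rewrite mulrC EFinM -mass moment_abs_le// /supported_in.
by rewrite opprB addrC.
Qed.

Lemma supported_moment_integrable (R : realType) (mu : {measure set R -> \bar R})
  (q : R) (n : nat) : (0 <= q)%R -> supported_in mu (- q) q ->
  mu setT < +oo -> mu.-integrable setT (fun x => (x ^+ n)%:E).
Proof.
move=> q0 supp fin; apply/integrableP; split; first exact: measurable_expr_EFin.
apply: le_lt_trans (moment_abs_le _ q0 supp) _.
by rewrite lte_mul_pinfty// lee_fin exprn_ge0.
Qed.

(** Odd moments have integrands of both signs, so scaling is proved on positive and negative parts;
    integrability makes their difference meaningful. *)
Lemma integral_mscale_measure d (T : measurableType d) (R : realType)
  (mu : {measure set T -> \bar R}) (c : {nonneg R}) (f : T -> \bar R) :
  mu.-integrable setT f ->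
  \int[mscale c mu]_x f x = c%:num%:E * \int[mu]_x f x.
Proof.
move=> fint; have mf := measurable_int _ fint.
rewrite [in LHS]integralE [in RHS]integralE.
rewrite ge0_integral_mscale//; last exact: measurable_funepos.
rewrite ge0_integral_mscale//; last exact: measurable_funeneg.
by rewrite [RHS]muleBr//; exact: integrable_add_def.
Qed.

(** Half the sum of the two representing measures represents the midpoint, with the same support. *)
Lemma moment_seq_midpoint (R : realType) (delta : R) (m1 m2 : int -> R) :
  (delta <= 1)%R -> moment_seq delta m1 -> moment_seq delta m2 ->
  moment_seq delta (fun k => (m1 k + m2 k) / 2)%R.
Proof.
move=> d1 [mu1 [supp1 rep1]] [mu2 [supp2 rep2]].
have intE (mu : {measure set R -> \bar R}) m n :
    supported_in mu (-1 + delta) (1 - delta) -> represents mu m ->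
    mu.-integrable setT (fun x => (x ^+ n)%:E).
  move=> supp rep; apply: (@supported_moment_integrable _ _ (1 - delta)).
  - by rewrite subr_ge0.
  - by rewrite opprB addrC.
  - by rewrite (represents_mass rep) ltry.
exists (mscale ((2^-1)%:nng)%R (measure_add mu1 mu2)); split.
  have add0 : measure_add mu1 mu2 (~` [set` `[-1 + delta, 1 - delta]%R]) = 0.
    by rewrite measure_addE [X in X + _]supp1 [X in _ + X]supp2 adde0.
  have := congr1 (mule (2^-1)%R%:E) add0.
  by rewrite mule0.
move=> k; have i1 := intE _ _ `|k|%N supp1 rep1; have i2 := intE _ _ `|k|%N supp2 rep2.
have mf := @measurable_expr_EFin R `|k|%N.
have add := integral_measure_add measurableT i1 i2.
rewrite integral_mscale_measure ?add.
  by rewrite /= -rep1 -rep2 mulrC EFinM EFinD.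
apply/integrableP; split => //; rewrite ge0_integral_measure_add//; last first.
  exact: measurableT_comp.
by rewrite lte_add_pinfty//; [case/integrableP: i1|case/integrableP: i2].
Qed.

(** * Sums over the integers and over the naturals *)

(** The shift in the second series comes from [Negz n] being [-(n + 1)]. *)
Lemma esum_absz (R : realType) (a : nat -> \bar R) : (forall n, 0 <= a n) ->
  \esum_(k in [set: int]) a `|k|%N = \sum_(n <oo) a n + \sum_(n <oo) a n.+1.
Proof.
move=> a0; rewrite (esumID (range Posz))// !setTI; congr (_ + _).
  rewrite esum_image; last by move=> m n _ _ [].
  by rewrite nneseries_esumT.
have -> : ~` range Posz = range Negz.
  apply/seteqP; split=> [[n|n] /= nN|_ /= [n _ <-] [m _]//]; last by exists n.
  by exfalso; apply: nN; exists n.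
rewrite esum_image; last by move=> m n _ _ [].
by rewrite nneseries_esumT.
Qed.

Lemma esum_absz_le (R : realType) (a : nat -> \bar R) : (forall n, 0 <= a n) ->
  \esum_(k in [set: int]) a `|k|%N <= \sum_(n <oo) a n + \sum_(n <oo) a n.
Proof.
move=> a0; rewrite esum_absz// leeD2l// [leRHS]nneseries_recl//.
rewrite -(@nneseries_addn _ a 1)//.
have -> : \sum_(n <oo) a (n + 1)%N = \sum_(n <oo) a n.+1.
  by apply: eq_eseriesr => n _; rewrite addn1.
by rewrite leeDr.
Qed.

Lemma nneseries_geometric_lty (R : realType) (c q : R) :
  (0 <= c)%R -> (0 <= q < 1)%R -> \sum_(n <oo) (c * q ^+ n)%:E < +oo.
Proof.
move=> c0 /andP[q0 q1].
have cvgS : series (geometric c q) @ \oo --> (c / (1 - q))%R.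
  by apply: cvg_geometric_series; rewrite ger0_norm.
suff -> : \sum_(n <oo) (c * q ^+ n)%:E = (c / (1 - q))%:E by rewrite ltry.
apply: cvg_lim => //; under eq_fun do rewrite sumEFin.
exact: cvg_EFin (nearW _ _) cvgS.
Qed.

(* Tannery's theorem, as dominated convergence for the counting measure. *)
Lemma cvg_nneseries_dominated (R : realType) (f : nat -> nat -> R)
  (g : nat -> R) :
  (forall M n, (`|f M n| <= g n)%R) -> \sum_(n <oo) (g n)%:E < +oo ->
  (forall n, f M n @[M --> \oo] --> (0:R)%R) ->
  \sum_(n <oo) `|f M n|%:E @[M --> \oo] --> 0.
Proof.
move=> fg gfin f0.
have g0 n : (0 <= g n)%R := le_trans (normr_ge0 _) (fg 0%N n).
have [//|//|||| _ _] := @dominated_convergence _ _ R counting setT measurableT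
  (fun M n => `|f M n|%:E) (cst 0) (EFin \o g).
- apply: aeW => n _; rewrite -[X in _ --> X]/(0%R%:E).
  apply: cvg_EFin; first exact: nearW.
  have := cvg_norm (f0 n); rewrite normr0; exact.
- apply/integrableP; split => //.
  rewrite ge0_integral_count//.
  by under eq_eseriesr do rewrite /= ger0_norm//.
- by apply: aeW => n M _ /=; rewrite normr_id lee_fin.
rewrite integral0; apply: cvg_trans; apply: near_eq_cvg; apply: nearW => M /=.
by rewrite ge0_integral_count.
Qed.

Lemma esumZl_le (R : realType) (T : choiceType) (I : set T) (c : R)
  (f : T -> \bar R) : (0 <= c)%R -> (forall i, 0 <= f i) ->
  \esum_(i in I) (c%:E * f i) <= c%:E * \esum_(i in I) f i.
Proof.
move=> c0 f0; apply: ge_ereal_sup => _ [X IX <-].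
rewrite -ge0_mule_fsumr//; apply: lee_wpmul2l; first by rewrite lee_fin.
by apply: ereal_sup_ubound; exists X.
Qed.

(** * The square norm and membership in [l2Z] *)

Lemma sqnorm_ge0 (R : realType) (m : int -> R) : 0 <= sqnorm m.
Proof. by apply: esum_ge0 => k _; rewrite lee_fin sqr_ge0. Qed.

Lemma sqr_le_sqnorm (R : realType) (m : int -> R) (k : int) :
  (m k ^+ 2)%:E <= sqnorm m.
Proof.
apply: esum_ge; exists [set k]; last by rewrite fsbig_set1.
by split => //; exact: finite_set1.
Qed.

(** Since [q <= 1], the squares are below [c ^+ 2 * q ^+ n], which is again geometric. *)
Lemma l2Z_decay (R : realType) (c q : R) (m : int -> R) :
  (0 <= q < 1)%R -> (forall k, `|m k| <= c * q ^+ `|k|)%R -> l2Z m.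
Proof.
move=> /andP[q0 q1] mq; rewrite /l2Z /= /sqnorm.
have c0 : (0 <= c)%R.
  by have := mq 0%R; rewrite expr0 mulr1; exact: le_trans.
apply: (@le_lt_trans _ _ (\esum_(k in [set: int]) (c ^+ 2 * q ^+ `|k|)%:E)).
  apply: le_esum => k _; rewrite lee_fin -real_normK ?num_real//.
  rewrite (@le_trans _ _ ((c * q ^+ `|k|) ^+ 2))%R// ?lerXn2r// ?nnegrE//.
    by rewrite mulr_ge0// exprn_ge0.
  rewrite exprMn ler_wpM2l ?sqr_ge0// expr2 ler_piMr ?exprn_ge0//.
  by rewrite exprn_ile1// ltW.
apply: le_lt_trans (@esum_absz_le _ (fun n => (c ^+ 2 * q ^+ n)%:E) _) _.
  by move=> n; rewrite lee_fin mulr_ge0 ?sqr_ge0 ?exprn_ge0.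
by rewrite lte_add_pinfty// nneseries_geometric_lty ?sqr_ge0 ?q0.
Qed.

Lemma l2ZB (R : realType) (m1 m2 : int -> R) :
  l2Z m1 -> l2Z m2 -> l2Z (m1 \- m2)%R.
Proof.
rewrite /l2Z /= => h1 h2; pose s m : \bar R := sqnorm m + sqnorm m.
have s_lty m : sqnorm m < +oo -> s m < +oo by move=> h; rewrite lte_add_pinfty.
apply: (@le_lt_trans _ _ (s m1 + s m2)); last by rewrite lte_add_pinfty ?s_lty.
have sq0 (m : int -> R) k : 0 <= (m k ^+ 2)%:E by rewrite lee_fin sqr_ge0.
rewrite /s /sqnorm -!esumD//; do ?by move=> *; rewrite adde_ge0.
apply: le_esum => k _; rewrite -!EFinD lee_fin /=.
(* Parallelogram law: [(a - b)^2 + (a + b)^2 = 2 a^2 + 2 b^2]. *)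
by have := sqr_ge0 (m1 k + m2 k); nra.
Qed.

Lemma moment_seq_l2Z (R : realType) (delta : R) (m : int -> R) :
  (0 < delta <= 1)%R -> moment_seq delta m -> l2Z m.
Proof.
move=> /andP[d0 d1] mm; apply: (@l2Z_decay _ (m 0%R) (1 - delta)).
  by rewrite subr_ge0 d1 ltrBlDr ltrDl.
by move=> k; have [] := moment_seq_decay k d1 mm.
Qed.

(** * Error bound for a single projection *)

(* Comparing [p] with the midpoint of [p] and [gam] replaces the variational
   inequality [<r - p, gam - p> <= 0]. *)
Lemma projection_error_le (R : realType) (delta eps : R) (gam r p : int -> R) :
  (0 < delta <= 1)%R -> moment_seq delta gam -> l2Z r ->
  argmin (moment_seq delta `&` @l2Z R) (fun m => sqnorm (r \- m)%R) p ->
  \esum_(k in [set: int]) (`|gam k - r k| * (1 - delta) ^+ `|k|)%:E <= eps%:E ->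
  sqnorm (gam \- p)%R <= (8 * gam 0 * eps + 4 * eps ^+ 2)%:E.
Proof.
move=> d01 mgam l2r [[mp l2p] minp] esum_le; have /andP[d0 d1] := d01.
have q0 : (0 <= 1 - delta)%R by rewrite subr_ge0.
have w0 k : (0 <= `|gam k - r k| * (1 - delta) ^+ `|k|)%R.
  by rewrite mulr_ge0// exprn_ge0.
have eps0 : (0 <= eps)%R.
  by rewrite -lee_fin; apply: le_trans esum_le; apply: esum_ge0 => k _; rewrite lee_fin.
have [gam0 _] := moment_seq_decay 0 d1 mgam.
have [p0 _] := moment_seq_decay 0 d1 mp.
pose mid k := ((p k + gam k) / 2)%R.
have mmid : moment_seq delta mid by exact: moment_seq_midpoint.
have le_mid : sqnorm (r \- p)%R <= sqnorm (r \- mid)%R.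
  by apply: minp; split => //; exact: moment_seq_l2Z mmid.
have sq0 (m : int -> R) k : 0 <= (m k ^+ 2)%:E by rewrite lee_fin sqr_ge0.
pose c := (2 * (gam 0 + p 0))%R.
have c0 : (0 <= c)%R by rewrite mulr_ge0// addr_ge0.
pose w k := (`|gam k - r k| * (1 - delta) ^+ `|k|)%R.
(* All terms are added rather than subtracted, as the norms are extended reals; doubling clears the
   denominator of the midpoint. *)
have main : sqnorm (r \- mid)%R + sqnorm (r \- mid)%R + sqnorm (gam \- p)%R <=
    sqnorm (r \- p)%R + sqnorm (r \- p)%R + (c * eps)%:E.
  apply: (@le_trans _ _ (sqnorm (r \- p)%R + sqnorm (r \- p)%R +
      \esum_(k in [set: int]) (c * w k)%:E)); last first.
    rewrite leeD2l// EFinM; apply: le_trans (lee_wpmul2l _ esum_le); rewrite ?lee_fin//.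
    by apply: (@esumZl_le _ _ _ c (fun k => (w k)%:E)) => // k; rewrite lee_fin w0.
  rewrite /sqnorm -!esumD//; do ?by move=> *; rewrite ?adde_ge0// lee_fin mulr_ge0// w0.
  apply: le_esum => k _; rewrite -!EFinD lee_fin /= /mid /c /w.
  have [_ gamk] := moment_seq_decay k d1 mgam.
  have [_ pk] := moment_seq_decay k d1 mp.
  have : ((gam k - p k) * (gam k - r k) <=
      (gam 0 + p 0) * (`|gam k - r k| * (1 - delta) ^+ `|k|))%R.
    rewrite (le_trans (ler_norm _))// normrM [leRHS]mulrCA mulrC ler_wpM2l//.
    by rewrite (le_trans (ler_normB _ _))// mulrDl lerD.
  (* Pointwise, [2 (r - mid)^2 + (3/2) (gam - p)^2 = 2 (r - p)^2 + 2 (gam - p)(gam - r)], so half a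
     square is left over. *)
  by have := sqr_ge0 (gam k - p k); nra.
(* Finiteness allows [|r - p|^2] to be cancelled once [le_mid] has put it in place of
   [|r - mid|^2]. *)
have Nfin : sqnorm (r \- p)%R \is a fin_num.
  by rewrite ge0_fin_numE ?sqnorm_ge0//; exact: l2ZB.
have S_le : sqnorm (gam \- p)%R <= (c * eps)%:E.
  rewrite -(@leeD2lE _ (sqnorm (r \- p)%R + sqnorm (r \- p)%R)) ?fin_numD ?Nfin//.
  by apply: le_trans main; rewrite leeD2r// leeD.
have Sfin : sqnorm (gam \- p)%R \is a fin_num.
  by rewrite ge0_fin_numE ?sqnorm_ge0// (le_lt_trans S_le)// ltry.
have := sqr_le_sqnorm (gam \- p)%R 0.
move: S_le; rewrite -(fineK Sfin) !lee_fin /c.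
set s := fine _ => /= S_le t_le.
(* With [t = gam 0 - p 0], [S_le] reads [s <= (4 gam 0 - 2 t) eps]; this square gives
   [- 4 t eps <= t^2 + 4 eps^2], and [t^2 <= s] is absorbed after doubling. *)
have := sqr_ge0 (gam 0 - p 0 + 2 * eps)%R.
by nra.
Qed.

(** * Convergence along a fixed path *)

Lemma moment_seq_even (R : realType) (delta : R) (m : int -> R) (k : int) :
  moment_seq delta m -> m k = m `|k|%N.
Proof. by move=> [mu [_ rep]]; apply: EFin_inj; rewrite !rep absz_nat. Qed.

(** An even sequence vanishing from [n] on decays geometrically: the factor [2 ^+ n] offsets the
    ratio [1/2] at indices below [n]. *)
Lemma l2Z_finite_support (R : realType) (m : int -> R) (n : nat) :
  (forall k, m k = m (- k)%R /\ (`|m k| <= m 0)%R) ->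
  (forall k, (n%:Z <= k)%R -> m k = 0%R) -> l2Z m.
Proof.
move=> m_even m_supp; apply: (@l2Z_decay R (m 0 * 2 ^+ n)%R 2^-1%R); first by lra.
move=> k; have m0 : (0 <= m 0)%R by have [_] := m_even 0%R; exact: le_trans.
have -> : m k = m `|k|%N.
  by case: (intP k) => [||j]//; rewrite abszN absz_nat (m_even _).1 opprK.
have [nk|kn] := leqP n `|k|.
  by rewrite m_supp// normr0 !mulr_ge0// exprn_ge0// invr_ge0.
rewrite (le_trans (m_even _).2)// -mulrA ler_peMr// exprVn.
by rewrite ler_pdivlMr ?exprn_gt0// mul1r ler_weXn2l ?ler1n// ltnW.
Qed.

Lemma moment_projection_cvg (R : realType) (delta : R)
  (Pi : (int -> R) -> int -> R) (gam : int -> R) (r : nat -> int -> R) :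
  (0 < delta <= 1)%R -> moment_projection delta Pi -> moment_seq delta gam ->
  (forall M, l2Z (r M)) ->
  (forall M k, r M k = r M (- k)%R /\ (`|r M k| <= r M 0)%R) ->
  (forall n : nat, r M n @[M --> \oo] --> gam n) ->
  sqnorm (gam \- Pi (r M))%R @[M --> \oo] --> 0.
Proof.
move=> d01 proj mgam l2r r_even r_cvg; have /andP[d0 d1] := d01.
have q0 : (0 <= 1 - delta)%R by rewrite subr_ge0.
(* Both sequences are even, so the weighted errors at natural indices determine all of them. *)
pose f M (n : nat) := ((gam n - r M n) * (1 - delta) ^+ n)%R.
have fE M k : (`|gam k - r M k| * (1 - delta) ^+ `|k|)%R = `|f M `|k|%N|%R.
  rewrite /f normrM (ger0_norm (exprn_ge0 _ q0)) (moment_seq_even k mgam).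
  by case: (intP k) => // j; rewrite abszN absz_nat (r_even _ (- _)%R).1 opprK.
have [gam0 _] := moment_seq_decay 0 d1 mgam.
(* One constant bounds every [r M n]: the convergent sequence [r M 0] is bounded and dominates the
   other entries. *)
have [C C0 rC] : exists2 C : R, (0 <= C)%R & forall M (n : nat), (`|r M n| <= C)%R.
  have /cvg_seq_bounded/pinfty_ex_gt0[C C0 rC] : cvgn (fun M => r M 0%N).
    by apply/cvg_ex; exists (gam 0%N); exact: r_cvg.
  exists C => [|M n]; first exact: ltW.
  by rewrite (le_trans (r_even M n).2)// (le_trans (ler_norm _))// rC.
have f_bound M n : (`|f M n| <= (gam 0 + C) * (1 - delta) ^+ n)%R.
  rewrite /f normrM (ger0_norm (exprn_ge0 _ q0)) ler_wpM2r ?exprn_ge0//.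
  rewrite (le_trans (ler_normB _ _))// lerD//.
  have [_ /le_trans] := moment_seq_decay n d1 mgam; apply.
  by rewrite ler_piMr// exprn_ile1// lerBlDr lerDl ltW.
have sum_cvg : \sum_(n <oo) `|f M n|%:E @[M --> \oo] --> 0.
  apply: cvg_nneseries_dominated f_bound _ _.
    by apply: nneseries_geometric_lty; [rewrite addr_ge0|rewrite q0/=; lra].
  move=> n; rewrite -[X in _ --> X](mul0r ((1 - delta) ^+ n)%R) /f.
  apply: cvgMr_tmp; rewrite -(subrr (gam n)).
  by apply: cvgB; [exact: cvg_cst|exact: r_cvg].
have /fine_cvgP[sum_fin fine_sum_cvg] := sum_cvg.
(* Two copies of the one-sided sum cover both signs, with index 0 counted twice. *)
pose eps M := (fine (\sum_(n <oo) `|f M n|%:E) + fine (\sum_(n <oo) `|f M n|%:E))%R.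
have eps_cvg : eps M @[M --> \oo] --> (0 : R)%R.
  by rewrite -[X in _ --> X](addr0 0%R); apply: cvgD.
apply: (@squeeze_cvge _ _ _ _ (cst 0) _
    (fun M => (8 * gam 0 * eps M + 4 * eps M ^+ 2)%:E)).
- near=> M; rewrite sqnorm_ge0 /=.
  apply: (projection_error_le d01 mgam (l2r M) (proj _ (l2r M))).
  under eq_esum do rewrite fE.
  apply: le_trans (@esum_absz_le _ (fun n => `|f M n|%:E) _) _ => //.
  by rewrite /eps EFinD fineK//; near: M.
- exact: cvg_cst.
- apply: cvg_EFin; first exact: nearW.
  have -> : (0 = 8 * gam 0 * 0 + 4 * (0 * 0) :> R)%R by rewrite !mulr0 addr0.
  apply: cvgD; first exact: cvgMl_tmp.
  by apply: cvgMl_tmp; apply: cvgM.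
Unshelve. all: by end_near.
Qed.

(** * From paths to almost sure convergence *)

Theorem theorem2 (R : realType) (X : completeMetricType R)
  (X_separable : separable_space X)
  (Q : R.-pker (borelType X) ~> (borelType X))
  (* P nu is the law of the chain started from nu *)
  (P : probability (borelType X) R ->
       probability (path_space (borelType X)) R)
  (P_law : forall nu, chain_law Q nu (P nu))
  (psi : {sigma_finite_measure set (borelType X) -> \bar R})
  (Q_irreducible : psi_irreducible P psi)
  (Q_aperiodic : aperiodic Q psi)
  (Q_harris : positive_harris_recurrent Q P psi)
  (pi : probability (borelType X) R)
  (Q_reversible : reversible Q pi)
  (Q_geometric : geometrically_ergodic Q pi)
  (g : borelType X -> R)
  (g_measurable : measurable_fun [set: borelType X] g)
  (g_square_integrable : \int[pi]_x (g x ^+ 2)%:E < +oo)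
  (F : {measure set R -> \bar R})
  (F_supported : supported_in F (-1) 1)
  (F_represents : represents F (autocovariance (P pi) g))
  (delta : R) (delta_gt0 : (0 < delta)%R) (delta_le1 : (delta <= 1)%R)
  (F_delta : supported_in F (-1 + delta) (1 - delta))
  (Pi : (int -> R) -> (int -> R))
  (Pi_projection : moment_projection delta Pi)
  (* the estimator is a function of the first M states *)
  (r : forall M : nat, M.-tuple (borelType X) -> int -> R)
  (R1 : forall (k : int) (x : X),
    {ae start_at P x, forall w,
      r M (first_states w M) k @[M --> \oo] --> autocovariance (P pi) g k})
  (R2 : forall M : nat, (0 < M)%N -> exists n : nat,
    forall (s : M.-tuple (borelType X)) (k : int), (n%:Z <= k)%R -> r M s k = 0%R)
  (R3 : forall M : nat, (0 < M)%N -> forall (s : M.-tuple (borelType X)) (k : int),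
    r M s k = r M s (- k)%R /\ (`|r M s k| <= r M s 0)%R) :
  forall x : X,
    {ae start_at P x, forall w,
      sqnorm (autocovariance (P pi) g \- Pi (r M (first_states w M)))%R
        @[M --> \oo] --> 0}.
Proof.
(* Countably many null sets, one for each natural lag, are merged; evenness handles negative
   lags. *)
move=> x; apply: filterS (ae_foralln (fun n => R1 (Posz n) x)) => w r_cvg.
(* (R.2) and (R.3) are assumed only for [0 < M], hence the passage to [M.+1]. *)
rewrite -cvg_shiftS /=.
apply: (moment_projection_cvg (r := fun M => r M.+1 (first_states w M.+1))
  _ Pi_projection).
- by rewrite delta_gt0.
- by exists F.
- move=> M; have [n r_supp] := R2 M.+1 (ltn0Sn M).
  by apply: l2Z_finite_support (r_supp _) => k; exact: R3.
- by move=> M k; exact: R3.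
- by move=> n; have := r_cvg n; rewrite -cvg_shiftS.
Qed.
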